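(* Fix an integer $m\ge1$, independent of $n$, and $c\in\mathbb R$; put $\lambda:=e^{-c}$ and $k=k_n(c):=\lfloor\frac nm(\log n+c)\rfloor$. Let $E=E_n$ be the number of indices in $[n]$ contained in none of $k$ independent uniformly random $m$-element subsets of $[n]$. Then, for each fixed integer $u\ge0$, as $n\to\infty$, $$P_k^{(m)}(u)=\mathbb P(E=u)\longrightarrow e^{-\lambda}\frac{\lambda^u}{u!}.$$ Equivalently, $E\Rightarrow\mathrm{Poisson}(\lambda)$ in distribution. Moreover, for each fixed $u\ge0$, $\mathbb E[(E)_u]\to\lambda^u$.
   Context: $(x)_u=x(x-1)\cdots(x-u+1)$ is the falling factorial, $(x)_0=1$. For fixed $m,c$, $k_n(c)\ge0$ for all sufficiently large $n$, which is the regime considered (with $n\ge m$). *)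

(* Defs.v *)
From HB Require Import structures.
From mathcomp Require Import all_boot all_order all_algebra.
From mathcomp Require Import all_classical all_reals all_analysis.
Import Order.TTheory GRing.Theory Num.Theory.
Import numFieldNormedType.Exports.

Set Implicit Arguments.
Unset Strict Implicit.
Unset Printing Implicit Defensive.

Local Open Scope classical_set_scope.
Local Open Scope ring_scope.

(* [n] is modelled by 'I_n, and a random subset of [n] by a function
   X : T -> {set 'I_n} on a probability space T, where the finite type
   {set 'I_n} carries the discrete sigma-algebra. *)

Definition discrete_measurable d (T : measurableType d) (U : Type)
    (X : T -> U) : Prop :=
  forall B : set U, measurable (X @^-1` B).

Definition uniform_subset d (T : measurableType d) (R : realType)
    (P : probability T R) (n m : nat) (X : T -> {set 'I_n}) : Prop :=
  forall A : {set 'I_n},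
    P (X @^-1` [set A]) =
      (if #|A| == m then ('C(n, m)%:R)^-1 else 0 : R)%:E.

(* Mutual independence of a finite family of variables taking values in a
   set U with the discrete sigma-algebra: product rule on every subfamily. *)
Definition mutually_independent d (T : measurableType d) (R : realType)
    (P : probability T R) (I : finType) (U : Type) (X : I -> T -> U) : Prop :=
  forall (J : {set I}) (B : I -> set U),
    P (\bigcap_(i in [set i | i \in J]) (X i @^-1` B i)) =
      (\prod_(i in J) P (X i @^-1` B i))%E.

Definition iid_uniform_subsets d (T : measurableType d) (R : realType)
    (P : probability T R) (n m k : nat) (X : 'I_k -> T -> {set 'I_n}) : Prop :=
  [/\ forall i, discrete_measurable (X i),
      forall i, uniform_subset P m (X i) &
      mutually_independent P X].

Definition uncovered (n k : nat) (A : 'I_k -> {set 'I_n}) : nat :=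
  #|[set j : 'I_n | [forall i : 'I_k, j \notin A i]]|.

(* Num.truncn is the floor on nonnegative reals and 0 on negative ones; for
   m >= 1 the argument below is nonnegative for all large n. *)
Definition num_draws (R : realType) (m : nat) (c : R) (n : nat) : nat :=
  Num.truncn (n%:R / m%:R * (ln n%:R + c)).

(* The natural-number argument of poisson_prob is a dummy: its value does not
   occur in the library definition. *)
Definition poisson_law (R : realType) (rate : R) : probability nat R :=
  poisson_prob rate 0%N.

(* Convergence in distribution Y_n => Z of real random variables, each defined
   on its own probability space, tested on bounded continuous functions. *)
Definition cvg_in_distribution (R : realType)
    (d : nat -> measure_display) (T : forall n, measurableType (d n))
    (P : forall n, probability (T n) R) (Y : forall n, T n -> R)
    d' (S : measurableType d') (Q : probability S R) (Z : S -> R) : Prop :=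
  forall f : R -> R, continuous f -> (exists M : R, forall x, `|f x| <= M) ->
    ('E_(P n)[f \o Y n] @[n --> \oo] --> 'E_Q[f \o Z])%E.

(* Main.v *)
(* Let E be the number of uncovered indices and q_u = C(n-u,m) / C(n,m), the
   probability that one draw misses u given indices. Summing over the u-subsets
   of uncovered indices gives E[(E)_u] = (n)_u q_u^k by independence. Since
   q_u is the product of 1 - m/(n-j) over j < u, this moment is the product
   over j < u of (n-j) (1 - m/(n-j))^k, and each factor tends to lambda by
   exp(-x/(1-x)) <= 1-x <= exp(-x) and (ln n)/n -> 0. The Bonferroni
   inequalities bracket P(E = u) between truncated alternating sums of binomial
   moments; letting n and then the truncation order tend to infinity gives the
   Poisson probabilities. Against a bounded f, the expectation of f(E) differs
   from its part on {E < J} by at most sup |f| P(E >= J), so convergence of the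
   point probabilities to a probability implies convergence in distribution. *)
Require Import Defs.
From mathcomp Require Import all_boot all_order all_algebra.
From mathcomp Require Import all_classical all_reals all_analysis.
From mathcomp Require Import ring lra zify.
Import Order.TTheory GRing.Theory Num.Theory.
Import numFieldNormedType.Exports.

Local Open Scope classical_set_scope.
Local Open Scope ring_scope.

(** * Binomial identities, Bonferroni bounds and a double-limit criterion *)

Lemma mul_bin_binD (j u v : nat) :
  ('C(j, u + v) * 'C(u + v, u) = 'C(j, u) * 'C(j - u, v))%N.
Proof.
(* Multiplied by u! v!, the two sides become (j)_{u+v} and (j)_u (j-u)_v. *)
apply/eqP; rewrite -(eqn_pmul2r (fact_gt0 u)) -(eqn_pmul2r (fact_gt0 v)); apply/eqP.
have uv := bin_fact (leq_addr v u); rewrite addKn in uv.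
rewrite -!mulnA uv bin_ffact.
rewrite (mulnCA 'C(j - u, v)) bin_ffact mulnA bin_ffact.
rewrite !ffact_prod big_split_ord/=; congr (_ * _)%N.
by apply: eq_bigr => i _; rewrite subnDA.
Qed.

(** Pascal's rule telescopes the sum, which is why row [r.+1] on the left becomes row [r] on the
    right. *)
Lemma sum_bin_alternate (R : pzRingType) (r M : nat) :
  \sum_(v < M.+1) (-1) ^+ v * 'C(r.+1, v)%:R = (-1) ^+ M * 'C(r, M)%:R :> R.
Proof.
elim: M => [|M IH]; first by rewrite big_ord1 !bin0.
by rewrite big_ord_recr/= IH binS natrD mulrDr exprS mulN1r !mulNr addrC addrNK.
Qed.

(** With C(j,u) factored out, an alternating partial sum of row j-u remains. For j > u it is
    C(j-u-1,M) up to sign, at most the first omitted term C(j-u,M+1) by Pascal's rule; for j = u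
    only v = 0 survives, and for j < u everything vanishes. *)
Lemma bonferroni (R : realDomainType) (j u M : nat) :
  `|(j == u)%:R - \sum_(v < M.+1) (-1) ^+ v * ('C(u + v, u) * 'C(j, u + v))%:R|
  <= ('C(u + M.+1, u) * 'C(j, u + M.+1))%:R :> R.
Proof.
have E v : ('C(u + v, u) * 'C(j, u + v) = 'C(j, u) * 'C(j - u, v))%N.
  by rewrite mulnC mul_bin_binD.
under eq_bigr => v _ do rewrite E natrM mulrCA.
rewrite -mulr_sumr E.
have [ju|uj|->] := ltngtP j u.
- by rewrite bin_small// mul0r subr0 normr0.
- rewrite sub0r normrN normrM normr_nat natrM ler_wpM2l//.
  have -> : (j - u = (j - u.+1).+1)%N by rewrite subnSK.
  rewrite sum_bin_alternate normrM normr_nat normrX normrN normr1 expr1n mul1r.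
  by rewrite ler_nat binS leq_addl.
- rewrite binn subnn mul1r big_ord_recl/= bin0 mulr1 big1 ?addr0 ?subrr ?normr0//.
  by move=> i _; rewrite mulr0.
Qed.

(** Induction on u: the new factor comes from (n-u) C(n-u-1,m) = (n-u-m) C(n-u,m). *)
Lemma bin_ratio (R : realFieldType) (n m u : nat) : (u + m <= n)%N ->
  'C(n - u, m)%:R / 'C(n, m)%:R
    = \prod_(j < u) (1 - m%:R / (n - j)%:R) :> R.
Proof.
elim: u => [|u IH] umn.
  by rewrite big_ord0 subn0 divff// pnatr_eq0 -lt0n bin_gt0.
rewrite big_ord_recr/= -IH; last by lia.
have Nu0 : (n - u)%:R != 0 :> R by rewrite pnatr_eq0; lia.
have /(congr1 (fun x => x%:R : R)) := mul_bin_down (n - u) m.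
rewrite -subnS !natrM [X in _ = X * _]natrB; last by lia.
move=> H.
apply: (mulfI Nu0); rewrite mulrA H.
by field; rewrite Nu0/= pnatr_eq0 -lt0n bin_gt0; lia.
Qed.

(** Serves both truncations, of Bonferroni sums and of expectations: n goes to infinity with the
    truncation order J fixed, and J follows. *)
Lemma cvg_double_limit (R : realType) (a : nat -> R)
    (s e : nat -> nat -> R) (S E : nat -> R) (l : R) :
  (forall J, \forall n \near \oo, `|a n - s J n| <= e J n) ->
  (forall J, s J n @[n --> \oo] --> S J) ->
  (forall J, e J n @[n --> \oo] --> E J) ->
  S J @[J --> \oo] --> l -> E J @[J --> \oo] --> 0 ->
  a n @[n --> \oo] --> l.
Proof.
move=> ase sS eE Sl El; apply/cvgrPdist_lt => eps eps0.
(* Four errors add up: |l - S J|, |S J - s J n|, E J and |E J - e J n|. *)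
have eps4 : 0 < eps / 4 by lra.
have [J [SJ EJ]] : exists J, `|l - S J| < eps / 4 /\ E J < eps / 4.
  have /cvgrPdist_lt/(_ _ eps4) H1 := Sl.
  have /cvgrPdist_lt/(_ _ eps4) H2 := El.
  have [J _ HJ] : \forall J \near \oo, `|l - S J| < eps / 4 /\ E J < eps / 4.
    near=> J; split; first by near: J.
    have : `|0 - E J| < eps / 4 by near: J.
    by rewrite sub0r normrN; apply: le_lt_trans; exact: ler_norm.
  by exists J; apply: HJ => /=.
have /cvgrPdist_lt/(_ _ eps4) Hs := sS J.
have /cvgrPdist_lt/(_ _ eps4) He := eE J.
near=> n.
have H1 : `|a n - s J n| <= e J n by near: n; exact: ase.
have H2 : `|S J - s J n| < eps / 4 by near: n.
have H3 : `|E J - e J n| < eps / 4 by near: n.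
move: SJ H1 H2 H3; rewrite !ltr_norml !ler_norml; lra.
Unshelve. all: end_near. Qed.

(** * Asymptotics of the factorial moments *)

Section asymptotics.
Context {R : realType}.

(** Since ln n = 2 ln (sqrt n) <= 2 sqrt n, the quotient is at most 2 / sqrt n. *)
Lemma cvg_ln_div_id : (ln n%:R / n%:R : R) @[n --> \oo] --> (0 : R).
Proof.
have inv0 : (n%:R^-1 : R) @[n --> \oo] --> (0 : R).
  apply/(@gtr0_cvgV0 R nat \oo _ (fun n => n%:R)); last exact: cvgr_idn.
  by near=> n; rewrite ltr0n; near: n; exact: nbhs_infty_gt.
have sq0 : (2 * Num.sqrt n%:R^-1 : R) @[n --> \oo] --> (0 : R).
  rewrite -[X in _ --> X](mulr0 2) -(sqrtr0 R); apply: cvgMr.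
  by apply: continuous_cvg inv0; exact: sqrt_continuous.
apply: (squeeze_cvgr _ (cvg_cst 0) sq0).
near=> n.
have n0 : 0 < n%:R :> R by rewrite ltr0n; near: n; exact: nbhs_infty_gt.
have n1 : 1 <= n%:R :> R by rewrite ler1n -(ltr0n R).
rewrite divr_ge0//= ?ln_ge0//.
rewrite sqrtrV; last exact: ltW.
have : 0 < Num.sqrt n%:R :> R by rewrite sqrtr_gt0.
have : Num.sqrt n%:R ^+ 2 = n%:R :> R by rewrite sqr_sqrtr ?ltW.
move: (Num.sqrt n%:R) => s <- s0.
rewrite lnXn// ler_pdivrMr ?exprn_gt0// expr2 mulrA divfK ?gt_eqF//.
by rewrite mulr_natl lerMn2r ltW ?orbT// ln_sublinear.
Unshelve. all: end_near. Qed.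

Lemma cvg_shift_inv (b : R) : ((n%:R - b)^-1 : R) @[n --> \oo] --> (0 : R).
Proof.
apply/(@gtr0_cvgV0 R nat \oo _ (fun n => n%:R - b)).
  by near=> n; rewrite subr_gt0; near: n; exact: nbhs_infty_gtr.
apply/cvgryPgt => A; near=> n.
by rewrite ltrBrDr; near: n; exact: nbhs_infty_gtr.
Unshelve. all: end_near. Qed.

Lemma cvg_shift_ratio (a b : R) :
  ((n%:R - a) / (n%:R - b) : R) @[n --> \oo] --> (1 : R).
Proof.
have H : (1 + (b - a) * (n%:R - b)^-1 : R) @[n --> \oo] --> (1 : R).
  rewrite -[X in _ --> X](addr0 1) -(mulr0 (b - a)).
  by apply: cvgD; [exact: cvg_cst|apply: cvgMr; exact: cvg_shift_inv].
apply: cvg_trans H; apply: near_eq_cvg; near=> n.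
have nb : n%:R - b != 0.
  by rewrite subr_eq0 gt_eqF//; near: n; exact: nbhs_infty_gtr.
by field.
Unshelve. all: end_near. Qed.

(* With k = n (ln n + c) / m - r and 0 <= r < 1, the exponent is
   - ln n - c + r m / (n - b) - b (ln n + c) / (n - b). *)
Lemma cvg_expR_num_draws (m : nat) (c a b : R) : (0 < m)%N ->
  ((n%:R - a) * expR (- ((num_draws m c n)%:R * (m%:R / (n%:R - b)))))
    @[n --> \oo] --> expR (- c).
Proof.
move=> m0.
have mR : 0 < m%:R :> R by rewrite ltr0n.
pose y n : R := n%:R / m%:R * (ln n%:R + c).
pose r n := y n - (num_draws m c n)%:R.
have lnb : ((ln n%:R + c) / (n%:R - b) : R) @[n --> \oo] --> (0 : R).
  have H : ((ln n%:R / n%:R) * ((n%:R - 0) / (n%:R - b)) + c * (n%:R - b)^-1 : R)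
      @[n --> \oo] --> (0 : R).
    have -> : 0 = 0 * 1 + c * 0 :> R by rewrite mul0r mulr0 addr0.
    apply: cvgD.
      by apply: cvgM; [exact: cvg_ln_div_id|exact: cvg_shift_ratio].
    by apply: cvgMr; exact: cvg_shift_inv.
  apply: cvg_trans H; apply: near_eq_cvg; near=> n.
  have nb : n%:R - b != 0.
    by rewrite subr_eq0 gt_eqF//; near: n; exact: nbhs_infty_gtr.
  have n0 : n%:R != 0 :> R.
    by rewrite pnatr_eq0 -lt0n; near: n; exact: nbhs_infty_gt.
  by field; rewrite n0 nb.
have rb : (r n * (m%:R / (n%:R - b)) : R) @[n --> \oo] --> (0 : R).
  have H : (m%:R * (n%:R - b)^-1 : R) @[n --> \oo] --> (0 : R).
    rewrite -[X in _ --> X](mulr0 m%:R).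
    by apply: cvgMr; exact: cvg_shift_inv.
  apply: (squeeze_cvgr _ (cvg_cst 0) H); near=> n.
  have nb : 0 < n%:R - b.
    by rewrite subr_gt0; near: n; exact: nbhs_infty_gtr.
  have n0 : 0 < n%:R :> R by rewrite ltr0n; near: n; exact: nbhs_infty_gt.
  (* For n >= e^{-c} the argument of [Num.truncn] is nonnegative, so truncation is the floor and 0
     <= r n < 1. *)
  have y0 : 0 <= y n.
    rewrite mulr_ge0 ?divr_ge0// -lerBlDr sub0r.
    rewrite -(expRK (- c)) ler_ln ?posrE ?expR_gt0//.
    by near: n; exact: nbhs_infty_ger.
  have mb : 0 <= m%:R / (n%:R - b) by rewrite divr_ge0// ltW.
  have /andP[ky yk] := truncn_itv y0.
  rewrite mulr_ge0//= ?subr_ge0// ler_piMl//.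
  by rewrite lerBlDr addrC natr1 ltW.
have ex : (- c + (r n * (m%:R / (n%:R - b)) - b * ((ln n%:R + c) / (n%:R - b))) : R)
    @[n --> \oo] --> - c.
  rewrite [X in _ --> X](_ : - c = - c + (0 - b * 0)); last first.
    by rewrite mulr0 subr0 addr0.
  apply: cvgD; first exact: cvg_cst.
  by apply: cvgB => //; exact: cvgMr.
have H : ((n%:R - a) / (n%:R - 0) * expR (- c + (r n * (m%:R / (n%:R - b))
      - b * ((ln n%:R + c) / (n%:R - b)))) : R) @[n --> \oo] --> expR (- c).
  rewrite -[X in _ --> X]mul1r; apply: cvgM; first exact: cvg_shift_ratio.
  by apply: continuous_cvg ex; exact: continuous_expR.
apply: cvg_trans H; apply: near_eq_cvg; near=> n.
have n0 : 0 < n%:R :> R by rewrite ltr0n; near: n; exact: nbhs_infty_gt.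
have nb : n%:R - b != 0.
  by rewrite subr_eq0 gt_eqF//; near: n; exact: nbhs_infty_gtr.
rewrite subr0 -mulrA; congr (_ * _).
(* The factor 1/n moves into the exponent, where it supplies the term - ln n. *)
have {1}-> : n%:R^-1 = expR (- ln n%:R) :> R by rewrite expRN lnK.
rewrite -expRD; congr expR.
rewrite /r /y; field.
by rewrite nb/= gt_eqF.
Unshelve. all: end_near. Qed.

(** Both bounds are 1 + y <= e^y, at y = -x and at y = x/(1-x), where 1 + y = 1/(1-x). *)
Lemma expR_sandwich (x : R) : x < 1 ->
  expR (- (x / (1 - x))) <= 1 - x <= expR (- x).
Proof.
move=> x1; rewrite expR_ge1Dx andbT.
have x1' : 0 < 1 - x by rewrite subr_gt0.
rewrite expRN -[leRHS]invrK lef_pV2 ?posrE ?invr_gt0 ?expR_gt0//.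
suff {1}-> : (1 - x)^-1 = 1 + x / (1 - x) by exact: expR_ge1Dx.
by field; rewrite gt_eqF.
Qed.

(** With x = m/(n-j) one has x/(1-x) = m/(n-j-m), so [expR_sandwich] squeezes the sequence between
    two instances of [cvg_expR_num_draws], with b = j+m below and b = j above; the limit does not
    depend on b. *)
Lemma cvg_draws_pow (m j : nat) (c : R) : (0 < m)%N ->
  ((n - j)%:R * (1 - m%:R / (n - j)%:R) ^+ num_draws m c n : R)
    @[n --> \oo] --> expR (- c).
Proof.
move=> m0.
have lo := @cvg_expR_num_draws m c j%:R (j%:R + m%:R) m0.
have hi := @cvg_expR_num_draws m c j%:R j%:R m0.
apply: (squeeze_cvgr _ lo hi); near=> n.
have jn : (j + m < n)%N by near: n; exact: nbhs_infty_gt.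
have N0 : 0 < n%:R - (j%:R + m%:R) :> R by rewrite -natrD subr_gt0 ltr_nat.
rewrite natrB; last by lia.
have m0' : 0 <= m%:R :> R by [].
have Nj : 0 < n%:R - j%:R :> R by lra.
set x := m%:R / (n%:R - j%:R).
have x1 : x < 1 by rewrite ltr_pdivrMr//; lra.
have /andP[xl xu] := expR_sandwich _ x1.
have -> : m%:R / (n%:R - (j%:R + m%:R)) = x / (1 - x).
  rewrite /x; field; rewrite !gt_eqF//; lra.
have ek y : expR (- ((num_draws m c n)%:R * y)) = expR (- y) ^+ num_draws m c n.
  by rewrite -mulrN expRM_natl.
have x0 : 0 <= 1 - x by rewrite subr_ge0 ltW.
clearbody x; rewrite !ek.
by rewrite !ler_pM2l// !lerXn2r// nnegrE expR_ge0.
Unshelve. all: end_near. Qed.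

Lemma cvg_ffact_ratio (m u : nat) (c : R) : (0 < m)%N ->
  ((n ^_ u)%:R * ('C(n - u, m)%:R / 'C(n, m)%:R) ^+ num_draws m c n : R)
    @[n --> \oo] --> expR (- c) ^+ u.
Proof.
move=> m0.
have H : (\prod_(j < u) ((n - j)%:R * (1 - m%:R / (n - j)%:R) ^+ num_draws m c n) : R)
    @[n --> \oo] --> expR (- c) ^+ u.
  have -> : expR (- c) ^+ u = \prod_(j < u) expR (- c).
    by rewrite prodr_const card_ord.
  apply: cvg_big; first exact: mul_continuous.
  by move=> j _; exact: cvg_draws_pow.
apply: cvg_trans H; apply: near_eq_cvg; near=> n.
rewrite big_split/= -natr_prod -ffact_prod; congr (_ * _).
rewrite prodrXl bin_ratio//.
by near: n; exact: nbhs_infty_ge.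
Unshelve. all: end_near. Qed.

End asymptotics.

(** * From binomial moments to point probabilities *)

Section moments_to_pmf.
Context {R : realType}.

(** [bonferroni] is averaged over j with weights [p j]; exchanging the finite sums produces the
    binomial moments. *)
Lemma bonferroni_pmf (p : nat -> R) (N u M : nat) :
  (forall j, 0 <= p j) -> (forall j, (N <= j)%N -> p j = 0) ->
  `|p u - \sum_(v < M.+1) (-1) ^+ v * 'C(u + v, u)%:R *
      \sum_(j < N) 'C(j, u + v)%:R * p j|
  <= 'C(u + M.+1, u)%:R * \sum_(j < N) 'C(j, u + M.+1)%:R * p j.
Proof.
move=> p0 pN.
have -> : p u = \sum_(j < N) (nat_of_ord j == u)%:R * p j.
  have [uN|Nu] := ltnP u N.
    rewrite (bigD1 (Ordinal uN))//= eqxx mul1r big1 ?addr0// => i iu.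
    by rewrite (_ : (nat_of_ord i == u) = false) ?mul0r//; exact: negbTE.
  rewrite pN// big1// => i _.
  by rewrite (_ : (nat_of_ord i == u) = false) ?mul0r//; apply/eqP => iu; have := ltn_ord i; lia.
under [X in _ - X]eq_bigr do rewrite mulr_sumr.
rewrite exchange_big/= -sumrB mulr_sumr.
apply: le_trans (ler_norm_sum _ _ _) _.
apply: ler_sum => j _.
under eq_bigr do rewrite !mulrA -[_ * _ * 'C(_, _)%:R]mulrA -natrM.
rewrite -mulr_suml -mulrBl normrM (ger0_norm (p0 _)) mulrA -natrM.
by rewrite ler_wpM2r// bonferroni.
Qed.

(** By [binE] the truncated sums tend to l^u/u! times partial sums of the exponential series at -l,
    and the error bounds to l^u/u! times l^(M+1)/(M+1)!, which vanishes as M grows. *)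
Lemma cvg_pmf_of_binomial_moments (p : nat -> nat -> R) (N : nat -> nat) (l : R) :
  (\forall n \near \oo, (forall j, 0 <= p n j) /\
                        (forall j, (N n <= j)%N -> p n j = 0)) ->
  (forall v, (\sum_(j < N n) 'C(j, v)%:R * p n j) @[n --> \oo] --> l ^+ v / v`!%:R) ->
  forall u, p n u @[n --> \oo] --> expR (- l) * (l ^+ u / u`!%:R).
Proof.
move=> hp hb u.
have binE v : 'C(u + v, u)%:R * (l ^+ (u + v) / (u + v)`!%:R)
    = l ^+ u / u`!%:R * (l ^+ v / v`!%:R).
  have := bin_fact (leq_addr v u); rewrite addKn => H.
  have -> : (u + v)`!%:R = 'C(u + v, u)%:R * (u`!%:R * v`!%:R) :> R.
    by rewrite -H !natrM.
  rewrite exprD; field.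
  by rewrite !pnatr_eq0 -!lt0n !fact_gt0 bin_gt0 leq_addr.
apply: (@cvg_double_limit R (p ^~ u)
  (fun M n => \sum_(v < M.+1) (-1) ^+ v * 'C(u + v, u)%:R *
      \sum_(j < N n) 'C(j, u + v)%:R * p n j)
  (fun M n => 'C(u + M.+1, u)%:R * \sum_(j < N n) 'C(j, u + M.+1)%:R * p n j)
  (fun M => l ^+ u / u`!%:R * series (exp_coeff (- l)) M.+1)
  (fun M => l ^+ u / u`!%:R * exp_coeff l M.+1)).
- move=> M; near=> n.
  have [p0 pN] : (forall j, 0 <= p n j) /\ (forall j, (N n <= j)%N -> p n j = 0).
    by near: n.
  exact: bonferroni_pmf.
- move=> M.
  have -> : l ^+ u / u`!%:R * series (exp_coeff (- l)) M.+1 =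
      \sum_(v < M.+1) (-1) ^+ v * 'C(u + v, u)%:R * (l ^+ (u + v) / (u + v)`!%:R).
    rewrite /series/= big_mkord mulr_sumr; apply: eq_bigr => v _.
    by rewrite -[RHS]mulrA binE /exp_coeff/= (exprNn l); ring.
  apply: cvg_big; first exact: add_continuous.
  by move=> v _; apply: cvgMr; exact: hb.
- by move=> M; rewrite /exp_coeff/= -binE; apply: cvgMr; exact: hb.
(* Truncation at order M keeps M + 1 terms, hence the shifted index. *)
- rewrite [X in _ --> X]mulrC; apply: cvgMr.
  have := @is_cvg_series_exp_coeff R (- l).
  by rewrite -(cvg_shiftS (series _)).
- rewrite -[X in _ --> X](mulr0 (l ^+ u / u`!%:R)); apply: cvgMr.
  by have := @cvg_exp_coeff R l; rewrite -(cvg_shiftS (exp_coeff l)).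
Unshelve. all: end_near. Qed.

End moments_to_pmf.

(** * Expectations of functions of a natural-valued variable *)

Section discrete_expectation.
Context {R : realType} {d : measure_display} {T : measurableType d}.
Variable P : probability T R.

Lemma integrable_simple (I : Type) (s : seq I) (Q : pred I) (c : I -> R)
    (A : I -> set T) : (forall i, measurable (A i)) ->
  P.-integrable setT (EFin \o (fun t => \sum_(i <- s | Q i) c i * \1_(A i) t)).
Proof.
move=> mA.
have -> : EFin \o (fun t => \sum_(i <- s | Q i) c i * \1_(A i) t) =
    (fun t => \sum_(i <- s | Q i) ((c i)%:E * (\1_(A i) t)%:E))%E.
  by apply/funext => t /=; rewrite -sumEFin.
apply: integrable_sum => // i _.
by exact: (integrableZl measurableT (c i) (integrable_indic P (mA i))).
Qed.

(** The filtered sum fits both uses: fibres over j < J, and u-subsets of [n] in the moment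
    computation. *)
Lemma expectation_simple (I : Type) (s : seq I) (Q : pred I) (c : I -> R)
    (A : I -> set T) : (forall i, measurable (A i)) ->
  ('E_P[fun t => (\sum_(i <- s | Q i) c i * \1_(A i) t)%R] =
    (\sum_(i <- s | Q i) c i * fine (P (A i)))%:E)%E.
Proof.
move=> mA; rewrite unlock.
under eq_integral do rewrite -sumEFin.
rewrite integral_sum//; last first.
  by move=> i; exact: (integrableZl measurableT (c i) (integrable_indic P (mA i))).
rewrite -sumEFin; apply: eq_bigr => i _.
rewrite (@integralZl _ _ _ _ _ _ (fun t => (\1_(A i) t)%:E))//.
  by rewrite integral_indic// setIT EFinM fineK// fin_num_measure.
exact: integrable_indic.
Qed.

Variable Y : T -> nat.
Hypothesis mY : measurable_fun setT Y.

Lemma measurable_fiber j : measurable (Y @^-1` [set j]).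
Proof. by rewrite -[X in measurable X]setTI; exact: mY. Qed.

Lemma fiber_indic j t : \1_(Y @^-1` [set j]) t = (Y t == j)%:R :> R.
Proof. rewrite indicE; congr (1 *+ nat_of_bool _).
by apply/idP/eqP => [/set_mem|Yt] //; exact: mem_set.
Qed.

Lemma sum_fiber_indic (f : nat -> R) (J : nat) (t : T) :
  \sum_(j < J) f j * \1_(Y @^-1` [set nat_of_ord j]) t
    = if (Y t < J)%N then f (Y t) else 0.
Proof.
under eq_bigr do rewrite fiber_indic.
case: ifPn => [YJ|]; last first.
  rewrite -leqNgt => JY; rewrite big1// => i _.
  by rewrite (_ : _ == _ = false) ?mulr0//; apply/eqP => Yi; have := ltn_ord i; lia.
rewrite (bigD1 (Ordinal YJ))//= eqxx mulr1 big1 ?addr0// => i iY.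
by rewrite (_ : _ == _ = false) ?mulr0// eq_sym; exact: negbTE.
Qed.

Lemma expectation_bounded_nat (f : nat -> R) (J : nat) :
  (forall t, (Y t < J)%N) ->
  ('E_P[fun t => f (Y t)] =
    (\sum_(j < J) f j * fine (P (Y @^-1` [set nat_of_ord j])))%:E)%E.
Proof.
move=> YJ; rewrite -expectation_simple; last by move=> i; exact: measurable_fiber.
by congr expectation; apply/funext => t; rewrite sum_fiber_indic YJ.
Qed.

Lemma integrable_bounded_nat (f : nat -> R) (M : R) : (forall j, `|f j| <= M) ->
  P.-integrable setT (EFin \o (fun t => f (Y t))).
Proof.
move=> fM; apply: measurable_bounded_integrable => //.
- exact: le_lt_trans (probability_le1 P measurableT) (ltry _).
- exact: (measurableT_comp (f := f)).
- exists M; split; first exact: num_real.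
  by move=> x Mx t _; exact: le_trans (fM _) (ltW Mx).
Qed.

Lemma expectation_bounded_fin_num (f : nat -> R) (M : R) :
  (forall j, `|f j| <= M) -> 'E_P[fun t => f (Y t)]%E \is a fin_num.
Proof.
move=> fM; rewrite unlock; apply: integrable_fin_num => //.
exact: integrable_bounded_nat _ _ fM.
Qed.

(** The truncation [g f] agrees with f(Y) on {Y < J} and is 0 elsewhere, so the difference is at
    most M times the indicator [1 - g (fun=> 1)] of {Y >= J}. Writing the tail as a complement
    leaves only finitely many point probabilities in the bound. *)
Lemma expectation_trunc (f : nat -> R) (M : R) (J : nat) :
  (forall j, `|f j| <= M) ->
  `|fine 'E_P[fun t => f (Y t)]%E -
     \sum_(j < J) f j * fine (P (Y @^-1` [set nat_of_ord j]))|
  <= M * (1 - \sum_(j < J) fine (P (Y @^-1` [set nat_of_ord j]))).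
Proof.
move=> fM.
have M0 : 0 <= M by exact: le_trans (fM 0%N).
have mfib i : measurable (Y @^-1` [set nat_of_ord (i : 'I_J)]) by exact: measurable_fiber.
pose g (f : nat -> R) t : R := \sum_(j < J) f j * \1_(Y @^-1` [set nat_of_ord j]) t.
have gE f' t : g f' t = if (Y t < J)%N then f' (Y t) else 0 by exact: sum_fiber_indic.
have ig f' : P.-integrable setT (EFin \o g f') by exact: integrable_simple.
have Eg f' : \int[P]_t g f' t = \sum_(j < J) f' j * fine (P (Y @^-1` [set nat_of_ord j])).
  by have := expectation_simple _ (index_enum 'I_J) xpredT (fun i => f' i) _ mfib;
    rewrite unlock /Rintegral => ->.
have intf := integrable_bounded_nat _ _ fM.
have -> : fine 'E_P[fun t => f (Y t)]%E = \int[P]_t f (Y t) by rewrite unlock.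
rewrite -Eg -RintegralB//.
have ifg : P.-integrable setT (EFin \o (fun t => f (Y t) - g f t)).
  exact: (integrableB measurableT intf (ig f)).
apply: le_trans (le_normr_Rintegral _ ifg) _ => //.
have i1 : P.-integrable setT (EFin \o (fun=> 1 : R)).
  exact: finite_measure_integrable_cst.
have ih : P.-integrable setT (EFin \o (fun t => 1 - g (fun=> 1) t)).
  exact: (integrableB measurableT i1 (ig _)).
have <- : \int[P]_t (M * (1 - g (fun=> 1) t)) =
    M * (1 - \sum_(j < J) fine (P (Y @^-1` [set nat_of_ord j]))).
  rewrite RintegralZl//.
  rewrite RintegralB// Eg Rintegral_cst// mul1r [X in fine X]probability_setT.
  by under eq_bigr do rewrite mul1r.
apply: le_Rintegral => //.
- exact: integrable_norm.
- exact: (integrableZl measurableT M ih).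
- move=> t _; rewrite !gE; case: ifPn => _.
    by rewrite !subrr normr0 mulr0.
  by rewrite !subr0 mulr1.
Qed.

End discrete_expectation.

(** * Measurability and factorial moments of the uncovered count *)

Section uncovered_moments.
Context {R : realType} {d : measure_display} {T : measurableType d}.
Variables (P : probability T R) (n m k : nat) (X : 'I_k -> T -> {set 'I_n}).

(** The count depends only on the tuple of draws, which takes finitely many values, so each preimage
    is a finite union of finite intersections of fibres. *)
Lemma measurable_uncovered : (forall i, Defs.discrete_measurable (X i)) ->
  measurable_fun setT (fun t => uncovered (fun i => X i t)).
Proof.
move=> mX _ B _; rewrite setTI.
pose D : set {ffun 'I_k -> {set 'I_n}} := [set F | B (uncovered F)].
rewrite (_ : _ @^-1` B = \bigcup_(F in D) \bigcap_(i in setT) (X i @^-1` [set F i])).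
  apply: fin_bigcup_measurable; first exact: finite_finset.
  move=> F _; apply: fin_bigcap_measurable; first exact: finite_finset.
  by move=> i _; exact: mX.
have uncE (F G : 'I_k -> {set 'I_n}) : F =1 G -> uncovered F = uncovered G.
  by move=> /funext ->.
apply/seteqP; split=> t /=.
  move=> Bt; exists [ffun i => X i t]; last by move=> i _ /=; rewrite ffunE.
  rewrite /D/= (uncE _ (fun i => X i t))// => i; exact: ffunE.
move=> [F BF tF]; rewrite (uncE _ F)// => i; exact: tF.
Qed.

Lemma card_disjoint_draws (S : {set 'I_n}) :
  #|[set A : {set 'I_n} | [disjoint S & A] & #|A| == m]%SET| = 'C(n - #|S|, m).
Proof.
have -> : (n - #|S| = #|~: S|)%N.
  by apply/eqP; rewrite -(eqn_add2l #|S|) cardsC card_ord subnKC// -[leqRHS]card_ord max_card.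
rewrite -cards_draws; apply: eq_card => A.
by rewrite !inE -finset.disjoints_subset disjoint_sym.
Qed.

Lemma probability_disjoint (Z : T -> {set 'I_n}) (S : {set 'I_n}) :
  Defs.discrete_measurable Z -> uniform_subset P m Z ->
  P (Z @^-1` [set A : {set 'I_n} | [disjoint S & A]%bool]) =
    ('C(n - #|S|, m)%:R / 'C(n, m)%:R)%:E.
Proof.
move=> mZ uZ; set D := [set A | _].
have -> : Z @^-1` D = \bigcup_(A in D) (Z @^-1` [set A]).
  by apply/seteqP; split=> t /=; [move=> Dt; exists (Z t)|move=> [A DA ->]].
rewrite measure_fin_bigcup//; last 2 first.
- exact: finite_finset.
- by move=> A B _ _ [t [/= <- <-]].
pose DS := [set A : {set 'I_n} | [disjoint S & A] & #|A| == m]%SET.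
have inDS A : (A \in enum DS) = [disjoint S & A]%bool && (#|A| == m).
  by rewrite mem_enum inE.
(* Values of size other than m have probability zero, so the sum reduces to the m-subsets in [D]. *)
rewrite -(@fsbig_widen _ _ _ _ [set` enum DS] D); last 2 first.
- by move=> A; rewrite /= inDS => /andP[].
- move=> A [DA nA] /=; rewrite uZ; case: ifPn => // Am.
  by exfalso; apply: nA; rewrite /= inDS Am andbT.
rewrite -fsbig_seq ?enum_uniq// big_enum/=.
under eq_bigr => A.
  by rewrite inE => /andP[_ Am]; rewrite uZ Am; over.
rewrite sumEFin sumr_const card_disjoint_draws; congr EFin.
by rewrite mulr_natl.
Qed.

Lemma probability_avoid (S : {set 'I_n}) : iid_uniform_subsets P m X ->
  P (\bigcap_(i in [set i | i \in [set: 'I_k]%SET])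
       (X i @^-1` [set A : {set 'I_n} | [disjoint S & A]%bool])) =
    (('C(n - #|S|, m)%:R / 'C(n, m)%:R) ^+ k)%:E.
Proof.
move=> [mX uX indX].
rewrite (indX _ (fun=> [set A : {set 'I_n} | [disjoint S & A]%bool])).
under eq_bigr do rewrite probability_disjoint//.
rewrite prodEFin prodr_const; congr ((_ ^+ _)%:E).
by rewrite cardsT card_ord.
Qed.

(* The set in the definition of uncovered is a classical one. *)
Lemma uncoveredE (A : 'I_k -> {set 'I_n}) :
  uncovered A = #|[set j | [forall i, j \notin A i]]%SET|.
Proof.
apply: eq_card => j; rewrite [RHS]finset.in_set.
by apply/idP/idP => [/set_mem|/mem_set].
Qed.

(** (E)_u = u! C(E,u), and C(E,u) counts the u-subsets of the uncovered set, that is, those avoided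
    by every draw. *)
Lemma ffact_uncovered (u : nat) (A : 'I_k -> {set 'I_n}) :
  (uncovered A ^_ u =
   \sum_(S : {set 'I_n} | #|S| == u) u`! * [forall i, [disjoint S & A i]])%N.
Proof.
rewrite -bin_ffact uncoveredE -cards_draws -big_distrr/= mulnC; congr (_ * _)%N.
rewrite -sum1_card big_mkcond [RHS]big_mkcond/=; apply: eq_bigr => S _.
rewrite inE andbC; case: (#|S| == u) => //=.
suff -> : (S \subset [set j | [forall i, j \notin A i]]%SET) = [forall i, [disjoint S & A i]].
  by case: forallP.
apply/fintype.subsetP/forallP => [SA i|SA j jS].
  rewrite disjoint_subset; apply/fintype.subsetP => j jS.
  by have := SA _ jS; rewrite !inE => /forallP/(_ i).
by rewrite inE; apply/forallP => i; rewrite (disjointFr (SA i) jS).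
Qed.

Lemma expectation_ffact_uncovered (u : nat) : iid_uniform_subsets P m X ->
  ('E_P[fun t => ((uncovered (fun i => X i t)) ^_ u)%N%:R] =
    ((n ^_ u)%:R * ('C(n - u, m)%:R / 'C(n, m)%:R) ^+ k)%:E)%E.
Proof.
move=> iidX; have [mX _ _] := iidX.
pose V (S : {set 'I_n}) := \bigcap_(i in [set i | i \in [set: 'I_k]%SET])
  (X i @^-1` [set A : {set 'I_n} | [disjoint S & A]%bool]).
have mV S : measurable (V S).
  apply: fin_bigcap_measurable; first exact: finite_finset.
  by move=> i _; exact: mX.
have -> : (fun t => ((uncovered (fun i => X i t)) ^_ u)%N%:R) =
    (fun t => \sum_(S : {set 'I_n} | #|S| == u) u`!%:R * \1_(V S) t) :> (T -> R).
  apply/funext => t; rewrite ffact_uncovered natr_sum; apply: eq_bigr => S _.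
  rewrite natrM indicE; congr (_ * (1 *+ nat_of_bool _)).
  apply/forallP/idP => [SX|/set_mem SX i]; last by apply: SX; rewrite /= finset.in_setT.
  by apply/mem_set => i _; exact: SX.
rewrite expectation_simple//; congr EFin.
under eq_bigr => S /eqP Su do rewrite probability_avoid// Su/=.
(* All C(n,u) summands are equal, and u! C(n,u) = (n)_u. *)
rewrite -mulr_suml sumr_const -cardsE card_draws card_ord; congr (_ * _).
by rewrite -bin_ffact natrM mulr_natl.
Qed.

End uncovered_moments.

(** * From point probabilities to convergence in distribution *)

Section poisson_law.
Context {R : realType}.

Lemma fine_poisson_law (l : R) (j : nat) : 0 < l ->
  fine (poisson_law l [set j]) = expR (- l) * (l ^+ j / j`!%:R).
Proof.
move=> l0; rewrite /poisson_law/= /poisson_prob l0 esum_set1.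
  by rewrite /poisson_pmf l0/= mulrC.
by rewrite lee_fin poisson_pmf_ge0.
Qed.

(** The normalisation e^{-l} e^l = 1, which ensures that no mass escapes to infinity. *)
Lemma cvg_sum_poisson_law (l : R) : 0 < l ->
  (\sum_(j < J) fine (poisson_law l [set nat_of_ord j])) @[J --> \oo] --> (1 : R).
Proof.
move=> l0.
have : expR (- l) * series (exp_coeff l) J @[J --> \oo] --> expR (- l) * expR l.
  by apply: cvgMr; exact: is_cvg_series_exp_coeff.
rewrite -expRD addNr expR0; apply: cvg_trans; apply: near_eq_cvg.
apply: nearW => J; rewrite /series/= big_mkord mulr_sumr.
by apply: eq_bigr => j _; rewrite fine_poisson_law.
Qed.

(** [expectation_trunc] is used twice: for [Y n], where sum and error are finite combinations of
    converging point probabilities, and for the Poisson law with the identity as variable, where J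
    grows and the tail vanishes. *)
Lemma cvg_in_distribution_poisson (d : nat -> measure_display)
    (T : forall n, measurableType (d n)) (P : forall n, probability (T n) R)
    (Y : forall n, T n -> nat) (l : R) : 0 < l ->
  (\forall n \near \oo, measurable_fun setT (Y n)) ->
  (forall u, fine (P n (Y n @^-1` [set u])) @[n --> \oo] -->
    expR (- l) * (l ^+ u / u`!%:R)) ->
  cvg_in_distribution P (fun n t => (Y n t)%:R)
    (poisson_law l) (fun j : nat => j%:R).
Proof.
move=> l0 mY pY f _ [M fM].
pose g (j : nat) : R := f j%:R.
have gM j : `|g j| <= M by exact: fM.
have mid : measurable_fun setT (id : nat -> nat) by [].
have fin_lim := expectation_bounded_fin_num (poisson_law l) _ mid g M gM.
have trunc_lim := expectation_trunc (poisson_law l) _ mid g M.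
have tail0 : (M * (1 - \sum_(j < J) fine (poisson_law l [set nat_of_ord j])))
    @[J --> \oo] --> (0 : R).
  have : (M * (1 - \sum_(j < J) fine (poisson_law l [set nat_of_ord j])))
      @[J --> \oo] --> M * (1 - 1).
    by apply: cvgMr; apply: cvgB; [exact: cvg_cst|exact: cvg_sum_poisson_law].
  by rewrite subrr mulr0.
suff : fine 'E_(P n)[fun t => g (Y n t)]%E @[n --> \oo] -->
    fine 'E_(poisson_law l)[fun j => g j]%E.
  move=> H; rewrite -(fineK fin_lim); apply/fine_cvgP; split=> //; near=> n.
  by apply: expectation_bounded_fin_num gM; near: n.
apply: (@cvg_double_limit R _
  (fun J n => \sum_(j < J) g j * fine (P n (Y n @^-1` [set nat_of_ord j])))
  (fun J n => M * (1 - \sum_(j < J) fine (P n (Y n @^-1` [set nat_of_ord j]))))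
  (fun J => \sum_(j < J) g j * fine (poisson_law l [set nat_of_ord j]))
  _ _ _ _ _ _ tail0).
- by move=> J; near=> n; apply: expectation_trunc gM; near: n.
- move=> J; apply: cvg_big; first exact: add_continuous.
  by move=> j _; apply: cvgMr; rewrite fine_poisson_law.
- move=> J; apply: cvgMr; apply: cvgB; first exact: cvg_cst.
  apply: cvg_big; first exact: add_continuous.
  by move=> j _; rewrite fine_poisson_law.
- apply/cvgrPdist_le => e e0; move/cvgrPdist_le/(_ _ e0): tail0.
  apply: filterS => J; rewrite sub0r normrN => tJ.
  apply: le_trans tJ; apply: le_trans (ler_norm _).
  exact: trunc_lim.
Unshelve. all: end_near. Qed.

End poisson_law.

(** * Point probabilities, law and factorial moments of the uncovered count *)

Theorem proposition4p8 (R : realType) (m : nat) (hm : (1 <= m)%N) (c : R)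
  (d : nat -> measure_display) (T : forall n : nat, measurableType (d n))
  (P : forall n : nat, probability (T n) R)
  (X : forall n : nat, 'I_(num_draws m c n) -> T n -> {set 'I_n})
  (hX : forall n : nat, (m <= n)%N -> iid_uniform_subsets (P n) m (X n)) :
  let lambda : R := expR (- c) in
  let E (n : nat) (t : T n) : nat := uncovered (fun i => X n i t) in
  [/\ forall u : nat,
        P n (E n @^-1` [set u]) @[n --> \oo] -->
          (expR (- lambda) * (lambda ^+ u / u`!%:R))%:E,
      cvg_in_distribution P (fun n t => (E n t)%:R)
        (poisson_law lambda) (fun j : nat => j%:R) &
      forall u : nat,
        ('E_(P n)[fun t => ((E n t) ^_ u)%N%:R] @[n --> \oo] -->
          (lambda ^+ u)%:E)%E].
Proof.
move=> lambda E.
have mE n : (m <= n)%N -> measurable_fun setT (E n).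
  by move=> /hX[mX _ _]; exact: measurable_uncovered.
(* At most n indices are uncovered, hence the support bound [succn] below. *)
have En n t : (E n t < n.+1)%N by rewrite ltnS -[leqRHS]card_ord max_card.
have EE n u : (m <= n)%N -> ('E_(P n)[fun t => ((E n t) ^_ u)%N%:R] =
    ((n ^_ u)%:R * ('C(n - u, m)%:R / 'C(n, m)%:R) ^+ num_draws m c n)%:E)%E.
  by move=> /hX iidX; exact: expectation_ffact_uncovered.
have near_m : \forall n \near \oo, (m <= n)%N by exact: nbhs_infty_ge.
have pmf_cvg u : fine (P n (E n @^-1` [set u])) @[n --> \oo] -->
    expR (- lambda) * (lambda ^+ u / u`!%:R).
  apply: (cvg_pmf_of_binomial_moments (fun n u => fine (P n (E n @^-1` [set u]))) succn).
    near=> n; split=> [j|j nj]; first exact: fine_ge0.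
    rewrite (_ : _ @^-1` _ = set0) ?measure0//.
    by apply/seteqP; split=> // t /= Etj; have := En n t; rewrite Etj ltnNge nj.
  move=> v.
  (* Dividing the factorial moment by v! gives the binomial moment. *)
  have H : ((n ^_ v)%:R * ('C(n - v, m)%:R / 'C(n, m)%:R) ^+ num_draws m c n / v`!%:R : R)
      @[n --> \oo] --> lambda ^+ v / v`!%:R.
    by apply: cvgMl; exact: cvg_ffact_ratio.
  apply: cvg_trans H; apply: near_eq_cvg; near=> n.
  have mn : (m <= n)%N by near: n.
  have := EE n v mn.
  rewrite (expectation_bounded_nat _ _ (mE n mn) (fun j => (j ^_ v)%:R) n.+1)//.
  move=> [<-]; rewrite mulr_suml; apply: eq_bigr => j _.
  by rewrite -bin_ffact natrM mulrAC mulfK.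
split.
(* A limit in the extended reals also requires eventual finiteness, which follows from measurability
   of the fibre for n >= m. *)
- move=> u; apply/fine_cvgP; split; last exact: pmf_cvg; near=> n.
  apply: fin_num_measure; apply: measurable_fiber; apply: mE; near: n.
  exact: near_m.
- apply: cvg_in_distribution_poisson => //; first exact: expR_gt0.
  by apply: filterS near_m => n; exact: mE.
- move=> u.
  have H : ((n ^_ u)%:R * ('C(n - u, m)%:R / 'C(n, m)%:R) ^+ num_draws m c n)%:E
      @[n --> \oo] --> (lambda ^+ u)%:E.
    by apply: cvg_EFin; [exact: nearW|exact: cvg_ffact_ratio].
  apply: cvg_trans H; apply: near_eq_cvg; near=> n.
  by rewrite EE//; near: n; exact: near_m.
Unshelve. all: end_near. Qed.
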